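(* Let $\mu,L,M>0$ and let $f:\mathbb{R}^n\to\mathbb{R}$ be three times continuously differentiable, $\mu$-strongly convex, with $L$-Lipschitz continuous gradient, and $M$-self-concordant. Let $\varkappa=L/\mu$, let $\mathbf{x}_*$ be the unique minimizer of $f$, let $\mathbf{x}_0\in\mathbb{R}^n$, let $\mathbf{B}_0\in\mathbb{R}^{n\times n}$ be symmetric positive definite, and let $(\mathbf{x}_k)_{k\ge0}$ be generated by the smoothness aided adaptive BFGS algorithm with parameters $M,L$ (with $\nabla f(\mathbf{x}_k)\ne\mathbf{0}$ for all $k$). Put $\Delta=f(\mathbf{x}_0)-f(\mathbf{x}_* )$, $\bar{\mathbf{B}}_0=\mathbf{B}_0/L$ and $\Gamma=(1+\sqrt2\,M\sqrt{\Delta})^2$. Then for all integers $k\ge1$, $$\frac{f(\mathbf{x}_k)-f(\mathbf{x}_* )}{f(\mathbf{x}_0)-f(\mathbf{x}_* )}\le\left(1-\frac{1}{\varkappa\min\{\Gamma,\varkappa\}}\exp\Bigl(-\frac{\Psi(\bar{\mathbf{B}}_0)}{k}\Bigr)\right)^{k}.$$ Furthermore, for all integers $k\ge 2\Psi(\bar{\mathbf{B}}_0)$, $$\frac{f(\mathbf{x}_k)-f(\mathbf{x}_* )}{f(\mathbf{x}_0)-f(\mathbf{x}_* )}\le\left(1-\frac{1}{2\varkappa\min\{\Gamma,\varkappa\}}\right)^{k}.$$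
   Context: $\|\cdot\|$ is the Euclidean norm for vectors, and $\|\mathbf{d}\|_{\mathbf{x}}=(\mathbf{d}^\top\nabla^2 f(\mathbf{x})\mathbf{d})^{1/2}$. The function $f$ is $\mu$-strongly convex if $f(\lambda\mathbf{x}+(1-\lambda)\mathbf{y})\le\lambda f(\mathbf{x})+(1-\lambda)f(\mathbf{y})-\frac{\lambda(1-\lambda)\mu}{2}\|\mathbf{x}-\mathbf{y}\|^2$ for all $\mathbf{x},\mathbf{y}\in\mathbb{R}^n$, $\lambda\in[0,1]$. It has $L$-Lipschitz gradient if $\|\nabla f(\mathbf{x})-\nabla f(\mathbf{y})\|\le L\|\mathbf{x}-\mathbf{y}\|$ for all $\mathbf{x},\mathbf{y}$. A convex $f$ is $M$-self-concordant if $|\nabla^3 f(\mathbf{x})[\mathbf{d},\mathbf{d},\mathbf{d}]|\le 2M\|\mathbf{d}\|_{\mathbf{x}}^3$ for all $\mathbf{x},\mathbf{d}$. For a symmetric positive definite $n\times n$ matrix $\mathbf{A}$, $\Psi(\mathbf{A})=\mathrm{Tr}(\mathbf{A})-\ln\det(\mathbf{A})-n$. Smoothness aided adaptive BFGS algorithm: for $k=0,1,2,\dots$ set $\mathbf{g}_k=\nabla f(\mathbf{x}_k)$, $\mathbf{d}_k=-\mathbf{B}_k^{-1}\mathbf{g}_k$, $\eta_k=-\mathbf{g}_k^\top\mathbf{d}_k/\|\mathbf{d}_k\|_{\mathbf{x}_k}$, $\alpha_k=\|\mathbf{d}_k\|_{\mathbf{x}_k}/(\sqrt L\,\|\mathbf{d}_k\|)$,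 $$\tilde t_k=\begin{cases}\dfrac{\eta_k}{(1+M\eta_k)\|\mathbf{d}_k\|_{\mathbf{x}_k}},&(1+M\eta_k)\alpha_k\le1,\\[2mm]\dfrac{M\eta_k\alpha_k^2+(1-\alpha_k)^2}{M\|\mathbf{d}_k\|_{\mathbf{x}_k}},&(1+M\eta_k)\alpha_k>1,\end{cases}$$ $\mathbf{x}_{k+1}=\mathbf{x}_k+\tilde t_k\mathbf{d}_k$, $\mathbf{s}_k=\mathbf{x}_{k+1}-\mathbf{x}_k$, $\mathbf{y}_k=\nabla f(\mathbf{x}_{k+1})-\nabla f(\mathbf{x}_k)$, and $$\mathbf{B}_{k+1}=\mathbf{B}_k-\frac{\mathbf{B}_k\mathbf{s}_k\mathbf{s}_k^\top\mathbf{B}_k}{\mathbf{s}_k^\top\mathbf{B}_k\mathbf{s}_k}+\frac{\mathbf{y}_k\mathbf{y}_k^\top}{\mathbf{y}_k^\top\mathbf{s}_k}.$$ *)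

(* Defs.v *)
From HB Require Import structures.
From mathcomp Require Import all_boot all_order all_algebra.
From mathcomp Require Import all_classical all_reals all_analysis.

Set Implicit Arguments.
Unset Strict Implicit.
Unset Printing Implicit Defensive.

Import Order.TTheory GRing.Theory Num.Theory.
Import numFieldNormedType.Exports.
Local Open Scope classical_set_scope.
Local Open Scope ring_scope.

Section Vectors.
Context {R : realType} {n : nat}.

Definition dot (u v : 'cV[R]_n) : R := (u^T *m v) 0 0.

(* R^n is 'cV[R]_n. The library norm `|v| on matrices is the sup norm, hence this definition. *)
Definition enorm (v : 'cV[R]_n) : R := Num.sqrt (dot v v).

Definition basis_vec (i : 'I_n) : 'cV[R]_n := delta_mx i 0.

Definition spd (A : 'M[R]_n) : Prop :=
  A^T = A /\ forall v : 'cV[R]_n, v != 0 -> 0 < dot v (A *m v).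

Definition Psi (A : 'M[R]_n) : R := \tr A - ln (\det A) - n%:R.

End Vectors.

Section Functions.
Context {R : realType} {n : nat}.
Implicit Types (f : 'cV[R]_n -> R) (x d : 'cV[R]_n).

(* f is C^(k+1) iff it is differentiable everywhere and all its directional
   derivatives are C^k; continuity in a finite-dimensional space does not
   depend on the norm, so the sup-norm topology of 'cV[R]_n is the usual one. *)
Fixpoint Ck (k : nat) f : Prop :=
  if k is k'.+1 then
    (forall x, differentiable f x) /\ (forall v, Ck k' (fun x => 'D_v f x))
  else continuous f.

Definition gradient f x : 'cV[R]_n := \col_i 'D_(basis_vec i) f x.

Definition hessian f x : 'M[R]_n :=
  \matrix_(i, j) 'D_(basis_vec i) (fun y => 'D_(basis_vec j) f y) x.

Definition third_derivative f x (u v w : 'cV[R]_n) : R :=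
  'D_u (fun y => 'D_v (fun z => 'D_w f z) y) x.

Definition local_norm f x d : R := Num.sqrt (dot d (hessian f x *m d)).

Definition strongly_convex (mu : R) f : Prop :=
  forall (x y : 'cV[R]_n) (l : R), 0 <= l <= 1 ->
    f (l *: x + (1 - l) *: y)
      <= l * f x + (1 - l) * f y - l * (1 - l) * mu / 2 * enorm (x - y) ^+ 2.

Definition lipschitz_gradient (L : R) f : Prop :=
  forall x y : 'cV[R]_n,
    enorm (gradient f x - gradient f y) <= L * enorm (x - y).

Definition self_concordant (M : R) f : Prop :=
  convex_function setT f /\
  forall x d,
    `|third_derivative f x d d d| <= 2 * M * local_norm f x d ^+ 3.

Definition unique_minimizer f x : Prop :=
  unique (fun z => forall y, f z <= f y) x.

Definition bfgs_direction f (B : 'M[R]_n) x : 'cV[R]_n :=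
  - (invmx B *m gradient f x).

Definition bfgs_step (M L : R) f (B : 'M[R]_n) x : R :=
  let d := bfgs_direction f B x in
  let dx := local_norm f x d in
  let eta := - dot (gradient f x) d / dx in
  let alpha := dx / (Num.sqrt L * enorm d) in
  if (1 + M * eta) * alpha <= 1
  then eta / ((1 + M * eta) * dx)
  else (M * eta * alpha ^+ 2 + (1 - alpha) ^+ 2) / (M * dx).

Definition bfgs_update (B : 'M[R]_n) (s y : 'cV[R]_n) : 'M[R]_n :=
  B - (dot s (B *m s))^-1 *: (B *m s *m s^T *m B)
    + (dot y s)^-1 *: (y *m y^T).

Definition adaptive_bfgs (M L : R) f (x0 : 'cV[R]_n) (B0 : 'M[R]_n)
    (x : nat -> 'cV[R]_n) (B : nat -> 'M[R]_n) : Prop :=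
  [/\ x 0%N = x0,
      B 0%N = B0 &
      forall k : nat,
        x k.+1 = x k + bfgs_step M L f (B k) (x k) *: bfgs_direction f (B k) (x k)
        /\ B k.+1 = bfgs_update (B k) (x k.+1 - x k)
                      (gradient f (x k.+1) - gradient f (x k))].

End Functions.

(* Main.v *)
Require Import Defs.
From mathcomp Require Import all_boot all_order all_algebra.
From mathcomp Require Import all_classical all_reals all_analysis.
From mathcomp Require Import ring lra.

(** Along the search direction, self-concordance bounds the second derivative by
    [delta^2 / (1 -+ M delta t)^2] and the Lipschitz gradient bounds it by
    [L |d|^2]; the step [t] minimizes the resulting upper model of [f]. Writing
    [D] for the decrease of [f], [g] for the gradient, [s] for the step vector and
    [y] for the change of gradient, this gives
    [(g.s)^2 <= 2 min(Gamma, kappa) D (y.s)].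
    On the other hand [|y|^2 <= L (y.s)] and [B s = - t g] imply that [Psi (B / L)]
    grows at each step by at most [ln r], where [r = L (g.s)^2 / (|g|^2 (y.s))].
    As [Psi >= 0], the product of the first [k] ratios [r] is at least
    [exp (- Psi (B0 / L))]. Since [2 mu (f - min f) <= |g|^2], a step multiplies
    [f - min f] by at most [1 - r / (kappa min(Gamma, kappa))], and two applications
    of the AM-GM inequality conclude. *)

Set Implicit Arguments.
Unset Strict Implicit.

Import Order.TTheory GRing.Theory Num.Theory.
Import numFieldNormedType.Exports.
Local Open Scope ring_scope.

(** * Derivative rules and comparison of increments on the real line *)

Section DeriveRules.
Context {R : realType}.
Implicit Types (f g : R -> R) (t a b c : R).

(* The library instances are stated for [f + g], [f * g] in the ring of
   functions, which unification does not find under a binder. *)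
Lemma is_derive_add f g t a b : is_derive t 1 f a -> is_derive t 1 g b ->
  is_derive t 1 (fun u => f u + g u) (a + b).
Proof. exact: is_deriveD. Qed.

Lemma is_derive_mul f g t a b : is_derive t 1 f a -> is_derive t 1 g b ->
  is_derive t 1 (fun u => f u * g u) (a * g t + f t * b).
Proof.
by move=> df dg; apply: is_derive_eq (is_deriveM df dg) _; rewrite addrC mulrC.
Qed.

Lemma is_derive_inv f t a : f t != 0 -> is_derive t 1 f a ->
  is_derive t 1 (fun u => (f u)^-1) (- a / f t ^+ 2).
Proof.
move=> ft df; apply: is_derive_eq (is_deriveV ft df) _.
by rewrite mulNr mulrC -mulNr.
Qed.

Lemma is_derive_affine t b c : is_derive t 1 (fun u => c + b * u) b.
Proof.
have h : is_derive t 1 (fun u => b * u) (0 * t + b * 1).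
  exact: (is_derive_mul (is_derive_cst _ _ _) (is_derive_id _ _)).
apply: is_derive_eq (is_derive_add (is_derive_cst c t 1) h) _.
by rewrite mul0r !add0r mulr1.
Qed.

Lemma is_derive_ln f t a : 0 < f t -> is_derive t 1 f a ->
  is_derive t 1 (fun u => ln (f u)) (a / f t).
Proof.
move=> ft df; apply: is_derive_eq (is_derive1_comp (is_derive1_ln ft) df) _.
exact: mulrC.
Qed.

(** The mean value theorem for [G - F]. It stands in for integration: the bounds below supply an
    explicit antiderivative as [F] or [G]. *)
Lemma le_increment (F G F' G' : R -> R) a b :
  a <= b ->
  (forall t, a <= t <= b -> is_derive t 1 F (F' t)) ->
  (forall t, a <= t <= b -> is_derive t 1 G (G' t)) ->
  (forall t, a <= t <= b -> F' t <= G' t) ->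
  F b - F a <= G b - G a.
Proof.
move=> ab dF dG le'.
have dH t : a <= t <= b -> is_derive t 1 (G - F) (G' t - F' t).
  by move=> tab; apply: is_deriveB; [exact: dG|exact: dF].
have [||c cab E] := @MVT_segment R (G - F) (fun t => G' t - F' t) a b ab.
- by move=> t; rewrite in_itv /= => /andP[/ltW at_ /ltW tb]; apply: dH; rewrite at_.
- apply: derivable_within_continuous => t; rewrite in_itv /= => tab.
  by have [] := dH t tab.
have : 0 <= (G - F) b - (G - F) a.
  rewrite E mulr_ge0 ?subr_ge0 // le' //.
rewrite /= !fctE; lra.
Qed.

End DeriveRules.

(** * Rational bounds on the logarithm, and the scalar inequality behind [Gamma] *)

Lemma ln1p_le (R : realType) (z : R) : 0 <= z ->
  ln (1 + z) <= z * (6 + z) / (6 + 4 * z).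
Proof.
move=> z0.
(* The bound is the Pade approximant of degrees 2 and 1; with denominators cleared, the derivatives
   differ by [4 t^3]. *)
have := @le_increment R (fun u => ln (1 + 1 * u))
  (fun u => (0 + 1 * u) * (6 + 1 * u) * (6 + 4 * u)^-1) (fun u => 1 / (1 + 1 * u))
  (fun u => ((6 + 2 * u) * (6 + 4 * u) - 4 * u * (6 + u)) / (6 + 4 * u) ^+ 2) 0 z z0.
rewrite !mulr0 !(mul1r, addr0, add0r) ln1 !mul0r !subr0; apply.
- move=> t /andP[t0 _]; have t1 : 0 < 1 + 1 * t by lra.
  exact: (@is_derive_ln _ (fun u => 1 + 1 * u) _ _ t1 (is_derive_affine t 1 1)).
- move=> t /andP[t0 _].
  have t6 : 6 + 4 * t != 0 by apply: lt0r_neq0; lra.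
  have dn := is_derive_mul (is_derive_affine t 1 0) (is_derive_affine t 1 6).
  have dd := @is_derive_inv _ (fun u => 6 + 4 * u) _ _ t6 (is_derive_affine t 4 6).
  apply: is_derive_eq (is_derive_mul dn dd) _.
  field; exact: t6.
- move=> t /andP[t0 _].
  have t1 : 0 < 1 + t by lra.
  have t6 : 0 < 6 + 4 * t by lra.
  rewrite !mul1r -[X in X <= _]div1r ler_pdivrMr // mulrAC ler_pdivlMr ?exprn_gt0 //.
  nra.
Qed.

(** The Pade approximant of degrees 1 and 1; the cleared derivatives differ by [t^2]. *)
Lemma ln1p_ge (R : realType) (z : R) : 0 <= z -> 2 * z / (2 + z) <= ln (1 + z).
Proof.
move=> z0.
have := @le_increment R (fun u => (0 + 2 * u) * (2 + 1 * u)^-1) (fun u => ln (1 + 1 * u))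
  (fun u => 4 / (2 + u) ^+ 2) (fun u => 1 / (1 + 1 * u)) 0 z z0.
rewrite !mulr0 !(mul1r, addr0, add0r) ln1 !mul0r !subr0; apply.
- move=> t /andP[t0 _].
  have t6 : 2 + 1 * t != 0 by apply: lt0r_neq0; lra.
  have dd := @is_derive_inv _ (fun u => 2 + 1 * u) _ _ t6 (is_derive_affine t 1 2).
  apply: is_derive_eq (is_derive_mul (is_derive_affine t 2 0) dd) _.
  rewrite !mul1r in t6 *; field; exact: t6.
- move=> t /andP[t0 _]; have t1 : 0 < 1 + 1 * t by lra.
  exact: (@is_derive_ln _ (fun u => 1 + 1 * u) _ _ t1 (is_derive_affine t 1 1)).
- move=> t /andP[t0 _].
  have t1 : 0 < 1 + t by lra.
  have t6 : 0 < 2 + t by lra.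
  rewrite !mul1r -[X in _ <= X]div1r ler_pdivrMr ?exprn_gt0 // mulrAC ler_pdivlMr //.
  nra.
Qed.

(** What is left of [model_bound] once denominators are cleared. With [z = B + c], the difference of
    the sides expands with nonnegative coefficients only. *)
Lemma model_poly_ge0 (R : realType) (B c : R) : 0 <= B -> 0 <= c ->
  let z := B + c in
  let D := (3 + 2 * z) * (2 + B) in
  let N := 3 * z ^+ 2 * (2 + B) + B ^+ 3 * (3 + 2 * z) in
  z ^+ 2 * (1 + 2 * z + B ^+ 2) * (D ^+ 2 * (2 + z))
  <= (N * D * (2 + 5 * z) + N ^+ 2 * (2 + z)) * (1 + z).
Proof.
move=> B0 c0 /=; rewrite -subr_ge0.
rewrite [X in 0 <= X](_ : _ =
    60 * B ^+ 3 + 220 * B ^+ 4 + 363 * B ^+ 5 + 368 * B ^+ 6 +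
    253 * B ^+ 7 + 116 * B ^+ 8 + 32 * B ^+ 9 + 4 * B ^+ 10 +
    72 * c ^+ 1 * B ^+ 2 + 406 * c ^+ 1 * B ^+ 3 + 821 * c ^+ 1 * B ^+ 4 + 950 * c ^+ 1 * B ^+ 5 +
    731 * c ^+ 1 * B ^+ 6 + 368 * c ^+ 1 * B ^+ 7 + 112 * c ^+ 1 * B ^+ 8 + 16 * c ^+ 1 * B ^+ 9 +
    72 * c ^+ 2 * B ^+ 1 + 456 * c ^+ 2 * B ^+ 2 + 872 * c ^+ 2 * B ^+ 3 + 969 * c ^+ 2 * B ^+ 4 +
    837 * c ^+ 2 * B ^+ 5 + 472 * c ^+ 2 * B ^+ 6 + 152 * c ^+ 2 * B ^+ 7 + 24 * c ^+ 2 * B ^+ 8 +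
    24 * c ^+ 3 + 328 * c ^+ 3 * B ^+ 1 + 698 * c ^+ 3 * B ^+ 2 + 556 * c ^+ 3 * B ^+ 3 +
    455 * c ^+ 3 * B ^+ 4 + 316 * c ^+ 3 * B ^+ 5 + 104 * c ^+ 3 * B ^+ 6 + 16 * c ^+ 3 * B ^+ 7 +
    76 * c ^+ 4 + 336 * c ^+ 4 * B ^+ 1 + 259 * c ^+ 4 * B ^+ 2 + 113 * c ^+ 4 * B ^+ 3 +
    109 * c ^+ 4 * B ^+ 4 + 40 * c ^+ 4 * B ^+ 5 + 4 * c ^+ 4 * B ^+ 6 + 52 * c ^+ 5 +
    76 * c ^+ 5 * B ^+ 1 + 21 * c ^+ 5 * B ^+ 2 + 14 * c ^+ 5 * B ^+ 3 + 8 * c ^+ 5 * B ^+ 4 +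
    4 * c ^+ 6 + 4 * c ^+ 6 * B ^+ 1 + 1 * c ^+ 6 * B ^+ 2); last ring.
by repeat apply: addr_ge0; repeat apply: mulr_ge0; rewrite ?exprn_ge0 ?ler0n.
Qed.

(** In the line search, [z = M eta], [q = 2 M^2 D] and the quotient on the left is [1 + M delta t];
    the factor [(1 + sqrt q)^2] is the source of [Gamma]. *)
Lemma model_bound (R : realType) (z B q : R) : 0 <= B -> B <= z ->
  3 * z ^+ 2 / (3 + 2 * z) + B ^+ 3 / (2 + B) <= q ->
  z ^+ 2 * ((1 + 2 * z + B ^+ 2) / (1 + z)) <= q * (1 + Num.sqrt q) ^+ 2.
Proof.
move=> B0 Bz; set q0 := (X in X <= q) => hq.
have z0 : 0 <= z by lra.
have [z1 z2 z3 B2] : [/\ 0 < 1 + z, 0 < 2 + z, 0 < 3 + 2 * z & 0 < 2 + B].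
  by split; lra.
have q0_ge0 : 0 <= q0.
  by rewrite addr_ge0 // divr_ge0 ?mulr_ge0 ?exprn_ge0 // ltW.
have q_ge0 : 0 <= q by lra.
(* A rational minorant of the root: [4 z^2 / (2 + z)^2 <= 3 z^2 / (3 + 2 z) <= q]. *)
have r_le : 2 * z / (2 + z) <= Num.sqrt q.
  rewrite -[X in X <= _]ger0_norm; last by rewrite divr_ge0 ?mulr_ge0 // ltW.
  rewrite -sqrtr_sqr ler_sqrt //; apply: le_trans hq.
  apply: (@le_trans _ _ (3 * z ^+ 2 / (3 + 2 * z))); last first.
    by rewrite lerDl divr_ge0 ?exprn_ge0 // ltW.
  rewrite expr_div_n ler_pdivrMr ?exprn_gt0 // mulrAC ler_pdivlMr //.
  nra.
have -> : q * (1 + Num.sqrt q) ^+ 2 = q + q ^+ 2 + 2 * q * Num.sqrt q.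
  by rewrite sqrrD sqr_sqrtr //; ring.
(* The expression increases with [q] and with its root, so each may be replaced by its rational
   minorant. *)
apply: (@le_trans _ _ (q0 + q0 ^+ 2 + 2 * q0 * (2 * z / (2 + z)))).
  have := @model_poly_ge0 R B (z - B) B0; rewrite subr_ge0 => /(_ Bz) /=.
  have -> : B + (z - B) = z by ring.
  set D := (3 + 2 * z) * (2 + B); set N := _ + B ^+ 3 * _ => key.
  have D0 : 0 < D by rewrite mulr_gt0.
  have -> : q0 = N / D by rewrite /q0 /N /D; field; rewrite !lt0r_neq0.
  have -> : N / D + (N / D) ^+ 2 + 2 * (N / D) * (2 * z / (2 + z)) =
     (N * D * (2 + 5 * z) + N ^+ 2 * (2 + z)) / (D ^+ 2 * (2 + z)).
    by field; rewrite !lt0r_neq0.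
  by rewrite mulrA ler_pdivlMr ?mulr_gt0 ?exprn_gt0 // mulrAC ler_pdivrMr.
have r_ge0 : 0 <= 2 * z / (2 + z) by rewrite divr_ge0 ?mulr_ge0 // ltW.
rewrite !lerD // ?lerXn2r // ler_pM // ?mulr_ge0 // ler_pM2l //.
Qed.

(** * Matrices and the BFGS update *)

Section DotTheory.
Context {R : realType} {n : nat}.
Implicit Types (u v w : 'cV[R]_n) (A : 'M[R]_n) (a : R).

Lemma dotE u v : dot u v = \sum_i u i 0 * v i 0.
Proof. by rewrite /dot mxE; apply: eq_bigr => i _; rewrite mxE. Qed.

Lemma dotC u v : dot u v = dot v u.
Proof. by rewrite !dotE; apply: eq_bigr => i _; rewrite mulrC. Qed.

Lemma dotDr u v w : dot u (v + w) = dot u v + dot u w.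
Proof. by rewrite /dot mulmxDr mxE. Qed.

Lemma dotZr a u v : dot u (a *: v) = a * dot u v.
Proof. by rewrite /dot -scalemxAr mxE. Qed.

Lemma dotNr u v : dot u (- v) = - dot u v.
Proof. by rewrite -scaleN1r dotZr mulN1r. Qed.

Lemma dotBr u v w : dot u (v - w) = dot u v - dot u w.
Proof. by rewrite dotDr dotNr. Qed.

Lemma dotDl u v w : dot (u + v) w = dot u w + dot v w.
Proof. by rewrite dotC dotDr !(dotC w). Qed.

Lemma dotZl a u v : dot (a *: u) v = a * dot u v.
Proof. by rewrite dotC dotZr dotC. Qed.

Lemma dotNl u v : dot (- u) v = - dot u v.
Proof. by rewrite dotC dotNr dotC. Qed.

Lemma dotBl u v w : dot (u - v) w = dot u w - dot v w.
Proof. by rewrite dotDl dotNl. Qed.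

Lemma dot0r u : dot u 0 = 0.
Proof. by rewrite /dot mulmx0 mxE. Qed.

Lemma dot0l u : dot 0 u = 0.
Proof. by rewrite dotC dot0r. Qed.

Lemma dot_trmx A u v : dot u (A *m v) = dot (A^T *m u) v.
Proof. by rewrite /dot trmx_mul trmxK mulmxA. Qed.

Lemma dot_ge0 u : 0 <= dot u u.
Proof. by rewrite dotE sumr_ge0 // => i _; exact: sqr_ge0. Qed.

Lemma dot_eq0 u : (dot u u == 0) = (u == 0).
Proof.
rewrite dotE psumr_eq0 => [|i _]; last exact: sqr_ge0.
apply/allP/eqP => [h|-> i _]; last by rewrite mxE mul0r eqxx.
apply/colP => i; have := h i (mem_index_enum i).
by rewrite /= mulf_eq0 orbb => /eqP ->; rewrite mxE.
Qed.

Lemma dot_gt0 u : u != 0 -> 0 < dot u u.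
Proof. by move=> u0; rewrite lt_def dot_eq0 u0 dot_ge0. Qed.

Lemma enorm_sqr u : enorm u ^+ 2 = dot u u.
Proof. by rewrite sqr_sqrtr // dot_ge0. Qed.

Lemma enorm_gt0 u : u != 0 -> 0 < enorm u.
Proof. by move=> u0; rewrite sqrtr_gt0 dot_gt0. Qed.

Lemma dot_sub_sqr a u v :
  dot (u - a *: v) (u - a *: v) = dot u u - 2 * a * dot u v + a ^+ 2 * dot v v.
Proof. by rewrite !(dotBl, dotBr, dotZl, dotZr) (dotC v u); ring. Qed.

Lemma cauchy_schwarz u v : dot u v <= enorm u * enorm v.
Proof.
have [->|v0] := eqVneq v 0.
  by rewrite dot0r mulr_ge0 // sqrtr_ge0.
apply: le_trans (ler_norm _) _.
rewrite -[leRHS]ger0_norm; last by rewrite mulr_ge0 // sqrtr_ge0.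
rewrite -ler_sqr ?nnegrE // !real_normK ?num_real // exprMn !enorm_sqr.
have vv := dot_gt0 v0.
have := dot_ge0 (u - (dot u v / dot v v) *: v); rewrite dot_sub_sqr.
rewrite (_ : _ + _ = dot u u - dot u v ^+ 2 / dot v v); last first.
  by field; rewrite lt0r_neq0.
by rewrite subr_ge0 ler_pdivrMr.
Qed.

Lemma mxtrace_outer u : \tr (u *m u^T) = dot u u.
Proof. by rewrite mxtrace_mulC trace_mx11. Qed.

Lemma outer_mulmx u v w : u *m v^T *m w = dot v w *: u.
Proof. by rewrite -mulmxA [_ *m w]mx11_scalar mul_mx_scalar. Qed.

End DotTheory.

(** Sylvester's identity: the two products in [E] factor the same block matrix. It reduces the
    rank-two BFGS update to a determinant of size 2. *)
Lemma det1D_mulC (R : comUnitRingType) (m n : nat) (U : 'M[R]_(n, m)) (V : 'M[R]_(m, n)) :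
  \det (1%:M + U *m V) = \det (1%:M + V *m U).
Proof.
have E : block_mx 1%:M 0 V 1%:M *m block_mx 1%:M (- U) 0 (1%:M + V *m U)
       = block_mx (1%:M + U *m V) (- U) 0 1%:M *m block_mx 1%:M 0 V 1%:M.
  rewrite !mulmx_block !(mul1mx, mulmx1, mulmx0, mul0mx, addr0, add0r).
  congr block_mx; first by rewrite mulNmx addrK.
  by rewrite mulmxN addrCA addNr addr0.
have := congr1 determinant E.
by rewrite !det_mulmx !det_lblock !det_ublock !det1 !mul1r !mulr1.
Qed.

(** Adding the second block column to the first puts an identity in the corner, and elimination then
    leaves [- X]. In [det_bfgs_update] this discards the entry containing [B^-1]. *)
Lemma det_antidiag_block (R : comUnitRingType) (m : nat) (X Y : 'M[R]_m) :
  \det (block_mx 0 1%:M X Y) = \det (- X).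
Proof.
have E : block_mx 0 1%:M X Y *m block_mx 1%:M 0 1%:M 1%:M
       = block_mx 1%:M 0 (X + Y) 1%:M *m block_mx 1%:M 1%:M 0 (- X).
  rewrite !mulmx_block !(mul1mx, mulmx1, mulmx0, mul0mx, addr0, add0r).
  by rewrite addrAC subrr add0r.
have := congr1 determinant E.
by rewrite !det_mulmx !det_lblock !det_ublock !det1 !mul1r !mulr1.
Qed.

Lemma ln_leB1 (R : realType) (x : R) : 0 < x -> ln x <= x - 1.
Proof.
by move=> x0; have := @le_ln1Dx R (x - 1); rewrite addrCA subrr addr0; apply; lra.
Qed.

Section SchurComplement.
Context {R : realType} {n : nat}.
Variable A : 'M[R]_(1 + n).
Hypothesis spdA : spd A.

Let a := A 0 0.
Let c : 'cV[R]_n := dlsubmx A.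
Let S : 'M[R]_n := drsubmx A - a^-1 *: (c *m c^T).

Let blockA : A = block_mx a%:M c^T c (drsubmx A).
Proof.
have [sym _] := spdA.
rewrite -{1}[A]submxK; congr block_mx; last by rewrite /c trmx_dlsub sym.
by rewrite [LHS]mx11_scalar !mxE !lshift0.
Qed.

Lemma schur_corner_gt0 : 0 < a.
Proof.
have [_ pos] := spdA; have := pos (delta_mx 0 0).
rewrite -colE dotE (bigD1 0) //= big1 => [|i i0]; last first.
  by rewrite mxE (negbTE i0) mul0r.
rewrite !mxE !eqxx mul1r addr0; apply.
by apply/eqP => /matrixP/(_ 0 0)/eqP; rewrite !mxE !eqxx oner_eq0.
Qed.

(** The first block of [w] is chosen to cancel the first block of [A w], so that
    [w.(A w) = v.(S v)]. *)
Lemma spd_schur : spd S.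
Proof.
have [sym pos] := spdA; split.
  by rewrite linearB linearZ /= trmx_mul trmxK trmx_drsub sym.
move=> v v0; pose w : 'cV[R]_(1 + n) := col_mx (- a^-1 *: (c^T *m v)) v.
have w0 : w != 0.
  apply: contra v0 => /eqP w0; apply/eqP.
  by rewrite -[v](col_mxKd (- a^-1 *: (c^T *m v))) -/w w0 linear0.
have := pos w w0; rewrite {1}blockA /w mul_block_col.
rewrite mul_scalar_mx scalerA mulrN divff ?lt0r_neq0 ?schur_corner_gt0 //.
rewrite scaleN1r addNr (_ : _ + _ *m v = S *m v); last first.
  by rewrite -scalemxAr scaleNr addrC mulmxBl -scalemxAl mulmxA.
by rewrite /dot tr_col_mx mul_row_col mulmx0 add0r.
Qed.

Lemma det_schur : \det A = a * \det S.
Proof.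
have -> : A = block_mx 1%:M 0 (a^-1 *: c) 1%:M *m block_mx a%:M c^T 0 S.
  rewrite {1}blockA mulmx_block !(mul1mx, mul0mx, mulmx0, addr0).
  rewrite -!scalemxAl mul_mx_scalar scalerA mulVf ?lt0r_neq0 ?schur_corner_gt0 //.
  by rewrite scale1r addrC subrK.
by rewrite det_mulmx det_lblock det_ublock !det1 !mul1r det_scalar1.
Qed.

Lemma mxtrace_schur : \tr A = a + \tr S + a^-1 * dot c c.
Proof.
rewrite {1}blockA mxtrace_block mxtrace_scalar mulr1n /S linearB linearZ /=.
by rewrite mxtrace_outer addrA subrK.
Qed.

End SchurComplement.

(** Induction by Schur complements, with pivots in the role of eigenvalues: a pivot [a] adds
    [a - 1 - ln a >= 0] to [Psi], and the trace adds a further [|c|^2 / a]. *)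
Lemma spd_det_gt0_Psi_ge0 (R : realType) (n : nat) (A : 'M[R]_n) :
  spd A -> 0 < \det A /\ 0 <= Psi A.
Proof.
elim: n A => [A _|n IH A spdA].
  by rewrite /Psi det_mx00 ln1 /mxtrace big_ord0 !subr0.
have [detS PsiS] := IH _ (spd_schur spdA).
have a0 := schur_corner_gt0 spdA.
rewrite /Psi (det_schur spdA); split; first exact: mulr_gt0.
rewrite (mxtrace_schur spdA) lnM // -natr1.
have := ln_leB1 a0; move: PsiS; rewrite /Psi.
have : 0 <= (A 0 0)^-1 * dot (dlsubmx (A : 'M[R]_(1 + n))) (dlsubmx (A : 'M[R]_(1 + n))).
  by rewrite mulr_ge0 ?dot_ge0 // invr_ge0 ltW.
move: (dot _ _) (\tr _) (ln (\det _)) => *; lra.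
Qed.

Section BfgsUpdate.
Context {R : realType} {n : nat}.
Implicit Types (B : 'M[R]_n) (s y : 'cV[R]_n).

Lemma spd_unitmx B : spd B -> B \in unitmx.
Proof.
by move=> /spd_det_gt0_Psi_ge0[d0 _]; rewrite unitmxE unitfE lt0r_neq0.
Qed.

Lemma spdZ (a : R) B : 0 < a -> spd B -> spd (a *: B).
Proof.
move=> a0 [sym pos]; split; first by rewrite linearZ /= sym.
by move=> v v0; rewrite -scalemxAl dotZr mulr_gt0 ?pos.
Qed.

Lemma bfgs_updateE B s y : B^T = B ->
  bfgs_update B s y = B - (dot s (B *m s))^-1 *: (B *m s *m (B *m s)^T)
    + (dot y s)^-1 *: (y *m y^T).
Proof. by move=> sym; rewrite /bfgs_update trmx_mul sym !mulmxA. Qed.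

(** Makes [B / L] a BFGS sequence for the gradient changes [y / L], which normalizes the smoothness
    constant to 1. *)
Lemma bfgs_updateZ (a : R) B s y : a != 0 ->
  a *: bfgs_update B s y = bfgs_update (a *: B) s (a *: y).
Proof.
move=> a0; rewrite /bfgs_update scalerDr scalerBr !scalerA.
rewrite -!scalemxAl -!scalemxAr [(a *: y)^T]linearZ /= -!scalemxAr dotZr dotZl.
rewrite !scalerA !invfM; congr (_ - _ *: _ + _ *: _).
  by rewrite [a^-1 * _]mulrC mulfVK // mulrC.
by rewrite [a^-1 * _]mulrC mulfVK // mulrC.
Qed.

(** The new form at [v] is the old one at [v - c s], with [c s] the [B]-orthogonal projection of [v]
    on [s], plus [(y.v)^2 / (y.s)]. If the first term vanishes, [v] is a nonzero multiple of [s] and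
    the second is positive. *)
Lemma spd_bfgs_update B s y : spd B -> s != 0 -> 0 < dot y s ->
  spd (bfgs_update B s y).
Proof.
move=> [sym pos] s0 ys0; rewrite bfgs_updateE //; split.
  by rewrite linearD linearB !linearZ /= !trmx_mul !trmxK sym.
move=> v v0; rewrite mulmxDl mulmxBl -!scalemxAl !outer_mulmx.
rewrite dotDr dotBr !dotZr (dotC v y) (dotC v (B *m s)).
have sBs0 := pos s s0.
pose c := dot (B *m s) v / dot s (B *m s).
have E : dot (v - c *: s) (B *m (v - c *: s)) =
    dot v (B *m v) - (dot s (B *m s))^-1 * (dot (B *m s) v * dot (B *m s) v).
  rewrite mulmxBr -scalemxAr !(dotBl, dotBr, dotZl, dotZr).
  rewrite [dot s (B *m v)]dot_trmx sym [dot v (B *m s)]dotC /c.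
  by field; rewrite lt0r_neq0.
rewrite -E; have [/eqP|vcs] := eqVneq (v - c *: s) 0.
  rewrite subr_eq0 => /eqP vE.
  have c0 : c != 0 by apply: contraNneq v0 => c0; rewrite vE c0 scale0r.
  rewrite vE subrr dot0l add0r dotZr.
  by rewrite mulr_gt0 ?invr_gt0 // -expr2 exprn_even_gt0 //= mulf_eq0 negb_or c0 lt0r_neq0.
by rewrite ltr_wpDr ?pos // mulr_ge0 ?invr_ge0 ?(ltW ys0) // -expr2 sqr_ge0.
Qed.

Lemma det_bfgs_update B s y : spd B -> s != 0 -> 0 < dot y s ->
  \det (bfgs_update B s y) = \det B * (dot y s / dot s (B *m s)).
Proof.
move=> spdB s0 ys0; have [sym pos] := spdB; have sBs0 := pos s s0.
have unitB := spd_unitmx spdB.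
set b := dot s (B *m s); set e := dot y s.
pose U := row_mx (- b^-1 *: s) (e^-1 *: (invmx B *m y)).
pose V := col_mx (s^T *m B) y^T.
have -> : bfgs_update B s y = B *m (1%:M + U *m V).
  rewrite /bfgs_update -/b -/e mulmxDr mulmx1 mul_row_col mulmxDr addrA.
  by rewrite -!(scalemxAl, scalemxAr) !mulmxA mulmxV // mul1mx scaleNr.
rewrite det_mulmx det1D_mulC; congr (_ * _).
rewrite mul_col_row (scalar_mx_block 1 1) add_block_mx !add0r.
have -> : s^T *m B *m (- b^-1 *: s) = - 1%:M.
  rewrite -scalemxAr -mulmxA [s^T *m _]mx11_scalar -[X in X%:M]/b.
  by rewrite scale_scalar_mx mulNr mulVf ?lt0r_neq0 // raddfN.
have -> : s^T *m B *m (e^-1 *: (invmx B *m y)) = 1%:M.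
  rewrite -scalemxAr -mulmxA mulKVmx // [s^T *m _]mx11_scalar.
  by rewrite -[X in X%:M]/(dot s y) dotC scale_scalar_mx mulVf ?lt0r_neq0.
have -> : y^T *m (- b^-1 *: s) = - (e / b)%:M.
  rewrite -scalemxAr [y^T *m _]mx11_scalar -[X in X%:M]/e.
  by rewrite scale_scalar_mx mulNr raddfN mulrC.
by rewrite subrr det_antidiag_block opprK det_scalar1.
Qed.

Lemma mxtrace_bfgs_update B s y : B^T = B ->
  \tr (bfgs_update B s y) =
  \tr B - dot (B *m s) (B *m s) / dot s (B *m s) + dot y y / dot y s.
Proof.
move=> sym; rewrite bfgs_updateE // mxtraceD raddfB /= !mxtraceZ !mxtrace_outer.
by congr (_ - _ + _); rewrite mulrC.
Qed.

(* With [a = |Bs|^2 / s.Bs], the first term uses [1 - a + ln a <= 0], which turns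
   the change of trace and determinant into the squared cosine of (s, Bs). *)
Lemma Psi_bfgs_update B s y : spd B -> s != 0 -> 0 < dot y s ->
  dot y y <= dot y s ->
  Psi (bfgs_update B s y) <=
  Psi B + ln (dot s (B *m s) ^+ 2 / (dot (B *m s) (B *m s) * dot y s)).
Proof.
move=> spdB s0 ys0 yys; have [sym pos] := spdB; have sBs0 := pos s s0.
have Bs0 : 0 < dot (B *m s) (B *m s).
  by apply: dot_gt0; apply: contraTneq sBs0 => ->; rewrite dot0r ltxx.
have [detB _] := spd_det_gt0_Psi_ge0 spdB.
rewrite /Psi mxtrace_bfgs_update // det_bfgs_update //.
set b := dot s _ in sBs0 *; set e := dot y s in ys0 yys *.
set w := dot (B *m s) _ in Bs0 *.
have -> : b ^+ 2 / (w * e) = (b / e) / (w / b).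
  by field; rewrite !lt0r_neq0.
rewrite [ln (b / e / _)]ln_div ?posrE ?divr_gt0 // [ln (\det _ * _)]lnM ?posrE ?divr_gt0 //.
have -> : ln (e / b) = - ln (b / e) by rewrite -invf_div lnV ?posrE ?divr_gt0.
have := @ln_leB1 R (w / b); rewrite divr_gt0 // => /(_ isT).
have : dot y y / e <= 1 by rewrite ler_pdivrMr ?mul1r.
by move=> *; lra.
Qed.

End BfgsUpdate.

(** * Smooth strongly convex functions *)

(** The derivative is a limit of right difference quotients, all nonnegative. Used at [t = 0] to
    pass from inequalities on a segment to gradient and Hessian bounds. *)
Lemma is_derive_right_ge0 (R : realType) (psi : R -> R) (t a : R) :
  is_derive t 1 psi a -> (forall h, 0 < h <= 1 -> psi t <= psi (t + h)) -> 0 <= a.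
Proof.
move=> [dpsi <-] le_psi.
have cv : (h^-1 *: (psi (h *: 1 + t) - psi t) @[h --> 0^'+] --> 'D_1 psi t)%classic.
  exact/cvg_dnbhs_at_right.
apply: (cvgr_to_ge cv); near=> h.
have h0 : 0 < h by near: h; exact: nbhs_right_gt.
rewrite /GRing.scale /= mulr_ge0 ?invr_ge0 ?(ltW h0) // subr_ge0 mulr1 addrC.
apply: le_psi; rewrite h0 /=; near: h; exact: nbhs_right_ltW.
Unshelve. all: by end_near. Qed.

Section SmoothFunctions.
Context {R : realType} {n : nat}.
Implicit Types (f F : 'cV[R]_n -> R) (x y d v : 'cV[R]_n) (t : R).

Lemma is_derive_line F x d t : derivable F (x + t *: d) d ->
  is_derive t 1 (fun u => F (x + u *: d)) ('D_d F (x + t *: d)).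
Proof.
pose g := fun u : R => F (x + u *: d).
have E : (fun h : R => h^-1 *: ((g \o shift t) (h *: 1) - g t)) =
         (fun h => h^-1 *: ((F \o shift (x + t *: d)) (h *: d) - F (x + t *: d))).
  apply/funext => h; rewrite /g /= [h *: 1]mulr1 scalerDl.
  by rewrite addrCA.
by move=> dF; split; rewrite /derivable ?/derive E.
Qed.

Lemma basis_vec_sum v : v = \sum_i v i 0 *: basis_vec i.
Proof.
by rewrite {1}[v]matrix_sum_delta; apply: eq_bigr => i _; rewrite big_ord1.
Qed.

Lemma derive_gradient f x v : differentiable f x -> 'D_v f x = dot (gradient f x) v.
Proof.
move=> df; rewrite deriveE // {1}[v]basis_vec_sum linear_sum dotE.
by apply: eq_bigr => i _; rewrite linearZ /= -deriveE // mxE mulrC.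
Qed.

Lemma derive2_hessian f x d : (forall y, differentiable f y) ->
  (forall v y, differentiable ('D_v f) y) ->
  'D_d ('D_d f) x = dot d (hessian f x *m d).
Proof.
move=> df ddf; rewrite derive_gradient // dotC !dotE.
apply: eq_bigr => i _; congr (_ * _); rewrite [LHS]mxE [RHS]mxE.
(* Expanding the inner derivative over the basis first gives the index order of [hessian]. *)
have -> : 'D_d f = \sum_j (d j 0 \*: 'D_(basis_vec j) f).
  apply/funext => y; rewrite derive_gradient // dotC dotE fct_sumE.
  by apply: eq_bigr => j _; rewrite mxE.
rewrite derive_sum => [|j]; last exact/derivableZ/diff_derivable.
apply: eq_bigr => j _; rewrite deriveZ; last exact/diff_derivable.
by rewrite mxE mulrC.
Qed.

Section Line.
Variables (f : 'cV[R]_n -> R) (x d : 'cV[R]_n).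
Hypothesis C3 : Ck 3 f.

Lemma is_derive_line1 t :
  is_derive t 1 (fun u => f (x + u *: d)) (dot (gradient f (x + t *: d)) d).
Proof.
have [df _] := C3; rewrite -derive_gradient //.
exact/is_derive_line/diff_derivable.
Qed.

Lemma is_derive_line2 t :
  is_derive t 1 (fun u => dot (gradient f (x + u *: d)) d)
    (dot d (hessian f (x + t *: d) *m d)).
Proof.
have [df ddf] := C3; rewrite -derive2_hessian // => [|v y]; last first.
  by have [] := ddf v.
have -> : (fun u => dot (gradient f (x + u *: d)) d) = (fun u => 'D_d f (x + u *: d)).
  by apply/funext => u; rewrite derive_gradient.
by apply/is_derive_line/diff_derivable; have [] := ddf d.
Qed.

Lemma is_derive_line3 t :
  is_derive t 1 (fun u => dot d (hessian f (x + u *: d) *m d))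
    (third_derivative f (x + t *: d) d d d).
Proof.
have [df ddf] := C3.
have -> : (fun u => dot d (hessian f (x + u *: d) *m d)) =
          (fun u => 'D_d ('D_d f) (x + u *: d)).
  apply/funext => u; rewrite derive2_hessian // => v y.
  by have [] := ddf v.
apply/is_derive_line/diff_derivable.
by have [_ /(_ d)[]] := ddf d.
Qed.

End Line.

Lemma lipschitz_gradient_dot (L : R) f x v t : lipschitz_gradient L f -> 0 <= t ->
  dot (gradient f (x + t *: v)) v <= dot (gradient f x) v + (L * dot v v) * t.
Proof.
move=> lip t0; rewrite -lerBlDl -dotBl.
apply: le_trans (cauchy_schwarz _ _) _.
have := lip (x + t *: v) x; rewrite addrAC subrr add0r => le_L.
apply: le_trans (ler_wpM2r (sqrtr_ge0 _) le_L) _.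
have -> : enorm (t *: v) = t * enorm v.
  by rewrite /enorm dotZl dotZr mulrA -expr2 sqrtrM ?sqr_ge0 // sqrtr_sqr ger0_norm.
by rewrite -[Num.sqrt _]/(enorm v) -enorm_sqr [leRHS](_ : _ = L * (t * enorm v) * enorm v) //; ring.
Qed.

Lemma descent_lemma (L : R) f x v : Ck 3 f -> lipschitz_gradient L f ->
  f (x + v) <= f x + dot (gradient f x) v + L / 2 * dot v v.
Proof.
move=> C3 lip.
(* The quadratic model is written with factors [c + b * u], the form that [is_derive_affine]
   differentiates. *)
have := le_increment (F := fun u => f (x + u *: v))
  (G := fun u => (0 + dot (gradient f x) v * u) + (0 + (L / 2 * dot v v) * u) * (0 + 1 * u)).
move=> /(_ (fun u => dot (gradient f (x + u *: v)) v)
   (fun u => dot (gradient f x) v + (L * dot v v) * u) 0 1 ler01).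
rewrite scale1r scale0r !addr0 !mulr0 !mulr1 !add0r mul0r subr0 lerBlDl addrA mulr1.
apply.
- by move=> t _; exact: is_derive_line1.
- move=> t _; have q := is_derive_mul (is_derive_affine t (L / 2 * dot v v) 0)
     (is_derive_affine t 1 0).
  apply: is_derive_eq (is_derive_add (is_derive_affine t _ 0) q) _.
  by field.
- by move=> t /andP[t0 _]; exact: lipschitz_gradient_dot.
Qed.

Lemma strongly_convex_first_order (mu : R) f x y : Ck 3 f -> strongly_convex mu f ->
  f y + dot (gradient f y) (x - y) + mu / 2 * dot (x - y) (x - y) <= f x.
Proof.
move=> C3 sc; set g := dot (gradient f y) _; set e := dot (x - y) (x - y).
(* By strong convexity, [c h + (mu / 2) e h^2 - f (y + h (x - y))] is smallest on [[0, 1]] at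
   [h = 0], where its derivative is [c - g]. *)
pose c := f x - f y - mu / 2 * e.
suff : 0 <= c + - g by rewrite /c; lra.
have q := is_derive_mul (is_derive_affine 0 (mu / 2 * e) 0) (is_derive_affine 0 1 0).
have p := is_derive_add (is_derive_affine 0 c 0) q.
have N : is_derive (0 : R) (1 : R) (fun u : R => - f (y + u *: (x - y))) (- g).
  rewrite /g; have := is_derive_line1 y (x - y) C3 0.
  by rewrite scale0r addr0 => h; exact: is_deriveN.
have D := is_derive_eq (is_derive_add p N) (_ : _ = c + - g).
apply: (is_derive_right_ge0 (D _)); first by ring.
move=> h /andP[h0 h1].
rewrite scale0r !add0r !mulr0 !addr0 add0r.
have := sc x y h; rewrite (ltW h0) h1 => /(_ isT); rewrite enorm_sqr -/e.
have -> : h *: x + (1 - h) *: y = y + h *: (x - y).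
  by rewrite scalerBl scalerBr scale1r addrCA.
by rewrite /c => *; nra.
Qed.

Lemma strongly_monotone_gradient (mu : R) f x y : Ck 3 f -> strongly_convex mu f ->
  mu * dot (x - y) (x - y) <= dot (gradient f x - gradient f y) (x - y).
Proof.
move=> C3 sc.
have := strongly_convex_first_order x y C3 sc.
have := strongly_convex_first_order y x C3 sc.
rewrite -(opprB x y) !(dotNr, dotNl); set v := x - y; rewrite dotBl; lra.
Qed.

Lemma strongly_convex_hessian (mu : R) f x d : Ck 3 f -> strongly_convex mu f ->
  mu * dot d d <= dot d (hessian f x *m d).
Proof.
move=> C3 sc.
have := is_derive_line2 x d C3 0; rewrite scale0r addr0 => D.
have := is_derive_add D (is_derive_affine 0 (- (mu * dot d d)) 0).
move=> /is_derive_right_ge0; rewrite subr_ge0; apply => h /andP[h0 _].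
rewrite scale0r !addr0 mulr0 add0r addr0.
have := strongly_monotone_gradient (x + h *: d) x C3 sc.
rewrite addrAC subrr add0r !(dotZl, dotZr) dotBl mulrCA ler_pM2l // !add0r => *; lra.
Qed.

Lemma lipschitz_gradient_hessian (L : R) f x d : Ck 3 f -> lipschitz_gradient L f ->
  dot d (hessian f x *m d) <= L * dot d d.
Proof.
move=> C3 lip.
have := is_derive_line2 x d C3 0; rewrite scale0r addr0 => D.
have := is_derive_add (is_derive_affine 0 (L * dot d d) 0) (is_deriveN D).
move=> /is_derive_right_ge0; rewrite subr_ge0; apply => h /andP[h0 _].
have := lipschitz_gradient_dot x d lip (ltW h0).
by rewrite /= !fctE scale0r !addr0 mulr0 !add0r => *; lra.
Qed.

(** The Polyak-Lojasiewicz inequality: the first-order bound is completed to the square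
    [|g + mu (y - x)|^2]. *)
Lemma gradient_dominated (mu : R) f x y : 0 < mu -> Ck 3 f -> strongly_convex mu f ->
  2 * mu * (f x - f y) <= dot (gradient f x) (gradient f x).
Proof.
move=> mu0 C3 sc; set g := gradient f x.
have := strongly_convex_first_order y x C3 sc; rewrite -/g.
have := dot_ge0 (g - (- mu) *: (y - x)); rewrite dot_sub_sqr.
move=> *; nra.
Qed.

(** Baillon-Haddad cocoercivity, the sum of [half] for [(x, y)] and [(y, x)]. Divided by [L^2], it
    is the hypothesis [|y|^2 <= y.s] of [Psi_bfgs_update] for the scaled update. *)
Lemma gradient_cocoercive (mu L : R) f x y : 0 <= mu -> 0 < L -> Ck 3 f ->
  strongly_convex mu f -> lipschitz_gradient L f ->
  dot (gradient f x - gradient f y) (gradient f x - gradient f y)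
  <= L * dot (gradient f x - gradient f y) (x - y).
Proof.
move=> mu0 L0 C3 sc lip.
(* Compare both bounds at [a - (grad f a - grad f b) / L]. *)
have half a b : let w := gradient f a - gradient f b in
    f b + dot (gradient f b) (a - b) + dot w w / (2 * L) <= f a.
  move=> w.
  have ww : dot w w = dot (gradient f a) w - dot (gradient f b) w by rewrite -dotBl.
  clearbody w; have := descent_lemma a (- (L^-1 *: w)) C3 lip.
  have := strongly_convex_first_order (a - L^-1 *: w) b C3 sc.
  have : 0 <= mu / 2 * dot (a - L^-1 *: w - b) (a - L^-1 *: w - b).
    by rewrite mulr_ge0 ?dot_ge0 // divr_ge0.
  rewrite [a - _ - b]addrAC.
  move: (_ * dot (_ - _) _) => e; rewrite !(dotBr, dotNr, dotNl, dotZr, dotZl).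
  rewrite ww invfM; set p := L^-1.
  have -> : L / 2 * - - (p * (p * (dot (gradient f a) w - dot (gradient f b) w)))
     = p * (dot (gradient f a) w - dot (gradient f b) w) / 2.
    by rewrite /p; field; rewrite lt0r_neq0.
  by move=> *; lra.
have := half y x; have /= := half x y; set v := x - y; set w := gradient f x - _.
have wv : dot w v = dot (gradient f x) v - dot (gradient f y) v by rewrite -dotBl.
rewrite -(opprB x y) -(opprB (gradient f x)) -/w -/v !(dotNr, dotNl, opprK) wv.
move=> h1 h2; rewrite mulrC -ler_pdivrMr //.
have -> : dot w w / L = dot w w / (2 * L) * 2 by field; rewrite lt0r_neq0.
lra.
Qed.

End SmoothFunctions.

(** * The adaptive step along a line *)

(** The [z^2] terms cancel, leaving twice [z (1 - a)^2 + (1 - a) + (1 - a)^2 / 2 + ln a], which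
    increases with [z]. The last hypothesis says [z >= (1 - a) / a], and
    [ln (1 / a) <= (1 - a) (1 + a) / (2 a)] settles that extreme case. *)
Lemma model_decrease_quad (R : realType) (z a : R) : 0 <= z -> 0 < a <= 1 ->
  1 <= (1 + z) * a ->
  z ^+ 2 * a ^+ 2 <=
  2 * ((z + 1) * (1 - a) + ln a + ((1 + z) * a - 1) ^+ 2 / 2).
Proof.
move=> z0 /andP[a0 a1] za.
have b0 : 0 <= a^-1 - 1 by rewrite subr_ge0 invf_ge1.
have := ln1p_le b0; rewrite addrC subrK lnV ?posrE //.
have -> : (a^-1 - 1) * (6 + (a^-1 - 1)) / (6 + 4 * (a^-1 - 1)) =
  (1 - a) * (1 + 5 * a) / (a * (4 + 2 * a)).
  by field; apply/andP; split; apply: lt0r_neq0; lra.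
move=> ln_a.
have c_le : (1 - a) * (1 + 5 * a) / (a * (4 + 2 * a)) <= (1 - a) * (1 + a) / (2 * a).
  have p0 : 0 < a * (4 + 2 * a) by rewrite mulr_gt0 //; lra.
  rewrite ler_pdivrMr // mulrAC ler_pdivlMr; last by lra.
  rewrite -subr_ge0 (_ : _ - _ = 2 * a * ((1 - a) * (1 - a) * (1 - a))) //; last by ring.
  by rewrite !mulr_ge0 //; lra.
have z_ge : (1 - a) / a <= z by rewrite ler_pdivrMr //; lra.
have z_ge2 : (1 - a) ^+ 2 * ((1 - a) / a) <= (1 - a) ^+ 2 * z.
  by rewrite ler_wpM2l ?sqr_ge0.
have : (1 - a) * (1 + a) / (2 * a) <=
  (1 - a) ^+ 2 * ((1 - a) / a) + (1 - a) + (1 - a) ^+ 2 / 2.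
  rewrite -subr_ge0 (_ : _ - _ = (1 - a) * (1 - a) * (1 - a) / (2 * a)).
    by rewrite !mulr_ge0 ?invr_ge0 //; lra.
  by field; rewrite lt0r_neq0.
have -> : ((1 + z) * a - 1) ^+ 2 / 2 = (z ^+ 2 * a ^+ 2
   + 2 * z * a ^+ 2 + a ^+ 2 - 2 * z * a - 2 * a + 1) / 2 by field.
move: ln_a c_le z_ge2; rewrite !expr2.
move: (ln a) (_ / (a * _)) (_ / (2 * a)) => l u v *; lra.
Qed.

Section LineSearch.
Context {R : realType}.
(** These stand for [f (x + t d)] and its first three derivatives in [t]; [delta] is the local norm
    of [d] and [rho] is [- g.d]. *)
Variables (phi phi1 phi2 phi3 : R -> R) (M delta rho : R).
Hypotheses (M0 : 0 < M) (delta0 : 0 < delta).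
Hypothesis d1 : forall t : R, is_derive t 1 phi (phi1 t).
Hypothesis d2 : forall t : R, is_derive t 1 phi1 (phi2 t).
Hypothesis d3 : forall t : R, is_derive t 1 phi2 (phi3 t).
Hypothesis phi2_gt0 : forall t, 0 < phi2 t.
Hypothesis phi3_le : forall t, `|phi3 t| <= 2 * M * Num.sqrt (phi2 t) ^+ 3.
Hypotheses (phi1_0 : phi1 0 = - rho) (phi2_0 : phi2 0 = delta ^+ 2).

Let r t := Num.sqrt (phi2 t).

Let r_gt0 t : 0 < r t.
Proof. by rewrite sqrtr_gt0. Qed.

Let r2 t : r t ^+ 2 = phi2 t.
Proof. by rewrite sqr_sqrtr // ltW. Qed.

Let r_0 : r 0 = delta.
Proof. by rewrite /r phi2_0 sqrtr_sqr gtr0_norm. Qed.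

(* Self-concordance says that [1 / sqrt phi''] is [M]-Lipschitz. *)
Let d_rinv (t : R) : is_derive t 1 (fun u : R => (r u)^-1) (- phi3 t / (2 * r t ^+ 3)).
Proof.
have dr : is_derive t 1 r ((2 * r t)^-1 * phi3 t).
  exact: (is_derive1_comp (is_derive1_sqrt (phi2_gt0 t)) (d3 t)).
apply: is_derive_eq (is_derive_inv (lt0r_neq0 (r_gt0 t)) dr) _.
by field; rewrite lt0r_neq0.
Qed.

Let rinv_slope t : - M <= - phi3 t / (2 * r t ^+ 3) <= M.
Proof.
have r3 : 0 < 2 * r t ^+ 3 by rewrite mulr_gt0 ?exprn_gt0.
have := phi3_le t; rewrite ler_norml -/(r t) => /andP[h1 h2].
by rewrite ler_pdivlMr // ler_pdivrMr //; apply/andP; split; lra.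
Qed.

Lemma rinv_le t : 0 <= t -> (r t)^-1 <= delta^-1 + M * t.
Proof.
move=> t0; have := le_increment t0 (fun u _ => d_rinv u)
  (fun u _ => is_derive_affine u M 0) (fun u _ => proj2 (andP (rinv_slope u))).
by rewrite r_0 mulr0 !add0r subr0 lerBlDl.
Qed.

Lemma rinv_ge t : 0 <= t -> delta^-1 - M * t <= (r t)^-1.
Proof.
move=> t0; have := le_increment t0 (fun u _ => is_derive_affine u (- M) 0)
  (fun u _ => d_rinv u) (fun u _ => proj1 (andP (rinv_slope u))).
by rewrite r_0 mulr0 !add0r subr0 lerBrDl mulNr.
Qed.

Lemma phi2_ge t : 0 <= t -> delta ^+ 2 / (1 + M * delta * t) ^+ 2 <= phi2 t.
Proof.
move=> t0; have p0 : 0 < 1 + M * delta * t by rewrite ltr_wpDr // !mulr_ge0 // ltW.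
rewrite -r2 -expr_div_n ler_sqr ?nnegrE ?(ltW (r_gt0 t)) ?divr_ge0 ?(ltW p0) ?(ltW delta0) //.
rewrite -[leRHS]invrK -[leLHS]invrK lef_pV2 ?posrE ?invr_gt0 ?divr_gt0 //.
apply: le_trans (rinv_le t0) _; rewrite invf_div.
by rewrite mulrDl mul1r mulrAC mulfK // lt0r_neq0.
Qed.

Lemma phi2_le t : 0 <= t -> M * delta * t < 1 ->
  phi2 t <= delta ^+ 2 / (1 - M * delta * t) ^+ 2.
Proof.
move=> t0 t1; have p0 : 0 < 1 - M * delta * t by rewrite subr_gt0.
rewrite -r2 -expr_div_n ler_sqr ?nnegrE ?(ltW (r_gt0 t)) ?divr_ge0 ?(ltW p0) ?(ltW delta0) //.
rewrite -[leRHS]invrK -[leLHS]invrK lef_pV2 ?posrE ?invr_gt0 ?divr_gt0 //.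
apply: le_trans (rinv_ge t0); rewrite invf_div.
by rewrite mulrBl mul1r mulrAC mulfK // lt0r_neq0.
Qed.

Lemma phi1_ge t : 0 <= t ->
  delta ^+ 2 * t / (1 + M * delta * t) <= phi1 t - phi1 0.
Proof.
move=> t0.
have p0 u : 0 <= u -> 0 < 1 + M * delta * u.
  by move=> u0; rewrite ltr_wpDr // !mulr_ge0 // ltW.
have := fun dF => le_increment
  (F := fun u => (0 + delta ^+ 2 * u) * (1 + M * delta * u)^-1)
  (F' := fun u => delta ^+ 2 / (1 + M * delta * u) ^+ 2) t0 dF (fun u _ => d2 u).
rewrite !mulr0 !add0r mul0r subr0; apply => u /andP[u0 _]; last exact: phi2_ge.
have pu := lt0r_neq0 (p0 u u0).
have q := @is_derive_inv _ (fun u => 1 + M * delta * u) _ _ pu (is_derive_affine _ _ _).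
apply: is_derive_eq (is_derive_mul (is_derive_affine u (delta ^+ 2) 0) q) _.
by field.
Qed.

Lemma phi1_le t : 0 <= t -> M * delta * t < 1 ->
  phi1 t <= - rho + delta ^+ 2 * t / (1 - M * delta * t).
Proof.
move=> t0 t1.
have p0 u : u <= t -> 0 < 1 + - (M * delta) * u.
  move=> ut; rewrite mulNr subr_gt0; apply: le_lt_trans t1.
  by rewrite ler_wpM2l // mulr_ge0 // ltW.
have := le_increment
  (G := fun u => (0 + delta ^+ 2 * u) * (1 + - (M * delta) * u)^-1)
  (G' := fun u => delta ^+ 2 / (1 - M * delta * u) ^+ 2) t0 (fun u _ => d2 u).
rewrite !mulr0 !add0r mul0r subr0 lerBlDl phi1_0 mulNr; apply => u /andP[u0 ut].
  have pu := lt0r_neq0 (p0 u ut).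
  have q := @is_derive_inv _ (fun u => 1 + - (M * delta) * u) _ _ pu (is_derive_affine _ _ _).
  apply: is_derive_eq (is_derive_mul (is_derive_affine u (delta ^+ 2) 0) q) _.
  by rewrite mulNr in pu *; field.
by apply: phi2_le => //; have := p0 u ut; rewrite mulNr subr_gt0.
Qed.

Lemma phi_le t : 0 <= t -> M * delta * t < 1 ->
  phi t <= phi 0 - rho * t - (M * delta * t + ln (1 - M * delta * t)) / M ^+ 2.
Proof.
move=> t0 t1.
have p0 u : u <= t -> 0 < 1 + - (M * delta) * u.
  move=> ut; rewrite mulNr subr_gt0; apply: le_lt_trans t1.
  by rewrite ler_wpM2l // mulr_ge0 // ltW.
(* The logarithm comes from [delta^2 u / (1 - M delta u) = (delta / M) (1 / (1 - M delta u) -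
   1)]. *)
have := le_increment
  (G := fun u => 0 + (- rho - delta / M) * u + cst (- M ^- 2) u * ln (1 + - (M * delta) * u))
  (G' := fun u => - rho + delta ^+ 2 * u / (1 - M * delta * u)) t0 (fun u _ => d1 u).
rewrite /= !(mulr0, addr0) ln1 !(mulr0, addr0, add0r, subr0) lerBlDl => H.
apply: le_trans (H _ _) _ => [u /andP[u0 ut]|u /andP[u0 ut]|].
- have pu := p0 u ut.
  have q := @is_derive_ln _ (fun u => 1 + - (M * delta) * u) _ _ pu (is_derive_affine _ _ _).
  have c := is_derive_mul (is_derive_cst (- M ^- 2) u 1) q.
  apply: is_derive_eq (is_derive_add (is_derive_affine u (- rho - delta / M) 0) c) _.
  by rewrite /= mulNr in pu *; field; rewrite !lt0r_neq0.
- by apply: phi1_le => //; have := p0 u ut; rewrite mulNr subr_gt0.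
- rewrite [- (M * delta) * t]mulNr [leLHS](_ : _ =
   phi 0 - rho * t - (M * delta * t + ln (1 - M * delta * t)) / M ^+ 2) //.
  by field; rewrite lt0r_neq0.
Qed.

Lemma phi_le_quad lam a b : a <= b -> (forall t, phi2 t <= lam) ->
  phi b <= phi a + phi1 a * (b - a) + lam / 2 * (b - a) ^+ 2.
Proof.
move=> ab le_lam.
have le1 t : a <= t -> phi1 t <= phi1 a + lam * (t - a).
  move=> at_; have := le_increment at_ (fun u _ => d2 u)
    (fun u _ => is_derive_affine u lam 0) (fun u _ => le_lam u).
  by rewrite !add0r -mulrBr lerBlDl.
have := le_increment
  (G := fun u => (0 + phi1 a * u) + (- (lam / 2 * a) + lam / 2 * u) * (- a + 1 * u))
  (G' := fun u => phi1 a + lam * (u - a)) ab (fun u _ => d1 u).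
rewrite lerBlDl => H.
apply: le_trans (H _ (fun u au => le1 u (proj1 (andP au)))) _ => [u _|]; last first.
  by rewrite [leLHS](_ : _ = phi a + phi1 a * (b - a) + lam / 2 * (b - a) ^+ 2) //; field.
have q := is_derive_mul (is_derive_affine u (lam / 2) (- (lam / 2 * a)))
  (is_derive_affine u 1 (- a)).
apply: is_derive_eq (is_derive_add (is_derive_affine u (phi1 a) 0) q) _.
by field.
Qed.

(** The problem is made dimensionless by [z = M eta], [tau = M delta t] and the scaled decrease
    [M^2 D]. The second conclusion leads to the bound with [kappa], the third, through
    [model_bound], to the one with [Gamma]. *)
Lemma adaptive_step_decrease (lam alpha t : R) :
  0 < rho -> 0 < alpha <= 1 -> delta ^+ 2 = alpha ^+ 2 * lam ->
  (forall u, phi2 u <= lam) ->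
  let eta := rho / delta in
  let D := phi 0 - phi t in
  t = (if (1 + M * eta) * alpha <= 1
       then eta / ((1 + M * eta) * delta)
       else (M * eta * alpha ^+ 2 + (1 - alpha) ^+ 2) / (M * delta)) ->
  [/\ 0 < t, rho ^+ 2 <= lam * (2 * D) &
      rho ^+ 2 * t <= 2 * D * (1 + Num.sqrt 2 * M * Num.sqrt D) ^+ 2 * (phi1 t - phi1 0)].
Proof.
move=> rho0 /andP[a0 a1] lamE le_lam eta D tE.
pose z := M * eta; have z0 : 0 < z by rewrite !mulr_gt0 ?invr_gt0.
have rhoE : rho = delta / M * z by rewrite /z /eta; field; rewrite !lt0r_neq0.
pose tau := M * delta * t.
(* [B] is [(1 + z) alpha - 1] in the second regime of the step and [0] in the first. *)
suff [t0 D_quad [B [B0 Bz DB tauE]]] : [/\ 0 < t, z ^+ 2 * alpha ^+ 2 <= 2 * M ^+ 2 * D &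
    exists B, [/\ 0 <= B, B <= z,
      3 * z ^+ 2 / (3 + 2 * z) + B ^+ 3 / (2 + B) <= 2 * M ^+ 2 * D &
      1 + tau = (1 + 2 * z + B ^+ 2) / (1 + z)]].
  split => //.
    have -> : rho ^+ 2 = lam / M ^+ 2 * (z ^+ 2 * alpha ^+ 2).
      by rewrite rhoE exprMn expr_div_n lamE; field; rewrite lt0r_neq0.
    have -> : lam * (2 * D) = lam / M ^+ 2 * (2 * M ^+ 2 * D).
      by field; rewrite lt0r_neq0.
    rewrite ler_wpM2l // divr_ge0 ?exprn_ge0 ?(ltW M0) //.
    exact: le_trans (ltW (phi2_gt0 0)) (le_lam 0).
  have := model_bound B0 Bz DB; rewrite -tauE.
  have -> : Num.sqrt (2 * M ^+ 2 * D) = Num.sqrt 2 * M * Num.sqrt D.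
    have M2 : 0 <= 2 * M ^+ 2 by rewrite mulr_ge0 ?sqr_ge0.
    by rewrite (sqrtrM _ M2) sqrtrM // sqrtr_sqr gtr0_norm.
  set G := (1 + _) ^+ 2 => key.
  have G0 : 0 <= G by exact: sqr_ge0.
  clearbody G.
  have D0 : 0 <= D.
    have : 0 <= 2 * M ^+ 2 * D by apply: le_trans D_quad; rewrite mulr_ge0 ?sqr_ge0.
    by rewrite pmulr_rge0 // mulr_gt0 // exprn_gt0.
  have tau0 : 0 < 1 + tau by rewrite ltr_wpDr // !mulr_ge0 // ltW.
  have := phi1_ge (ltW t0); rewrite -/tau => le_H.
  (* [phi1_ge] puts [1 + tau] in a denominator; moved across, it forms the product [z^2 (1 + tau)]
     that [key] bounds. *)
  apply: (@le_trans _ _ (2 * D * G * (delta ^+ 2 * t / (1 + tau)))); last first.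
    by apply: ler_wpM2l le_H; rewrite !mulr_ge0.
  rewrite [leRHS]mulrA ler_pdivlMr // rhoE.
  have -> : (delta / M * z) ^+ 2 * t * (1 + tau) =
     delta ^+ 2 * t / M ^+ 2 * (z ^+ 2 * (1 + tau)) by field; rewrite lt0r_neq0.
  have -> : 2 * D * G * (delta ^+ 2 * t) = delta ^+ 2 * t / M ^+ 2 * (2 * M ^+ 2 * D * G).
    by field; rewrite lt0r_neq0.
  by rewrite ler_wpM2l // !mulr_ge0 ?invr_ge0 ?sqr_ge0 // ltW.
have z1 : 0 < 1 + z by lra.
have ln_z := ln1p_le (ltW z0).
have w_ge : 3 * z ^+ 2 / (3 + 2 * z) <= 2 * (z - ln (1 + z)).
  have -> : 3 * z ^+ 2 / (3 + 2 * z) = 2 * (z - z * (6 + z) / (6 + 4 * z)).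
    by field; apply/andP; split; apply: lt0r_neq0; lra.
  lra.
move: tE; rewrite -/z; case: ifPn => [za|]; last rewrite -ltNge => za; move=> tE.
  (* First regime: [t] minimizes the logarithmic model of [phi_le], whose decrease is
     [(z - ln (1 + z)) / M^2]. *)
  have tauE : tau = z / (1 + z).
    by rewrite /tau tE /eta rhoE; field; rewrite !lt0r_neq0.
  have t0 : 0 < t by rewrite tE !divr_gt0 ?mulr_gt0.
  have tau1 : 1 - tau = (1 + z)^-1 by rewrite tauE; field; rewrite lt0r_neq0.
  have DW : z - ln (1 + z) <= M ^+ 2 * D.
    have := phi_le (ltW t0); rewrite -/tau -subr_gt0 tau1 invr_gt0 => /(_ z1).
    rewrite lnV ?posrE // => H.
    have rt : rho * t = z * tau / M ^+ 2.
      by rewrite /tau rhoE; field; rewrite !lt0r_neq0.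
    have : z * tau / M ^+ 2 + (tau - ln (1 + z)) / M ^+ 2 <= D by rewrite /D -rt; lra.
    rewrite -mulrDl ler_pdivrMr ?exprn_gt0 // [D * _]mulrC.
    have -> : z * tau + (tau - ln (1 + z)) = z - ln (1 + z).
      by rewrite tauE; field; rewrite lt0r_neq0.
    by [].
  split => //; last first.
    exists 0; split; rewrite ?(ltW z0) ?expr0n ?mul0r ?addr0 //; first lra.
    by rewrite tauE; field; rewrite lt0r_neq0.
  have a_le : alpha <= (1 + z)^-1 by rewrite -div1r ler_pdivlMr // mulrC.
  apply: (@le_trans _ _ (z ^+ 2 * (1 + z)^-1 ^+ 2)).
    rewrite ler_wpM2l ?sqr_ge0 // ler_sqr ?nnegrE ?(ltW a0) // invr_ge0 ltW //.
  apply: (@le_trans _ _ (3 * z ^+ 2 / (3 + 2 * z))); last lra.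
  rewrite exprVn ler_pdivrMr ?exprn_gt0 // mulrAC ler_pdivlMr; last lra.
  rewrite -subr_ge0 (_ : _ - _ = z ^+ 2 * (z * (4 + 3 * z))); last by ring.
  by apply: mulr_ge0 (sqr_ge0 _) _; apply: mulr_ge0 (ltW z0) _; lra.
have {}tE : t = (z * alpha ^+ 2 + (1 - alpha) ^+ 2) / (M * delta) by [].
pose A := (1 + z) * alpha.
have tauE : tau = z * alpha ^+ 2 + (1 - alpha) ^+ 2.
  by rewrite /tau tE; field; rewrite !lt0r_neq0.
have t0 : 0 < t.
  by rewrite tE divr_gt0 ?mulr_gt0 // ltr_pwDl ?sqr_ge0 // mulr_gt0 ?exprn_gt0.
(* [W / M^2] is the decrease of the upper model, which is quadratic beyond the
   point [t1] where [delta^2 / (1 - M delta t)^2] reaches [lam]. *)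
pose W := (z + 1) * (1 - alpha) + ln alpha + (A - 1) ^+ 2 / 2.
have DW : W <= M ^+ 2 * D.
  pose t1 := (1 - alpha) / (M * delta).
  have t10 : 0 <= t1 by rewrite divr_ge0 ?subr_ge0 // mulr_ge0 // ltW.
  have tau1 : M * delta * t1 = 1 - alpha.
    by rewrite /t1; field; rewrite !lt0r_neq0.
  (* From [t1] on, the step is the Newton step of the quadratic piece: the model slope
     [delta (A - 1) / (M alpha)] divided by the curvature [lam]. *)
  have tt1 : t - t1 = alpha * (A - 1) / (M * delta).
    by rewrite tE /t1 /A; field; rewrite !lt0r_neq0.
  have t1t : t1 <= t.
    by rewrite -subr_ge0 tt1 divr_ge0 ?mulr_ge0 ?subr_ge0 // ltW.
  have lt1 : M * delta * t1 < 1 by rewrite tau1; lra.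
  have := phi_le t10 lt1; have := phi1_le t10 lt1; rewrite tau1 subKr.
  have := phi_le_quad t1t le_lam; rewrite tt1.
  have -> : - rho + delta ^+ 2 * t1 / alpha = - (delta / (M * alpha) * (A - 1)).
    by rewrite rhoE /t1 /A; field; rewrite !lt0r_neq0.
  have -> : rho * t1 = z * (1 - alpha) / M ^+ 2.
    by rewrite rhoE /t1; field; rewrite !lt0r_neq0.
  have -> : lam / 2 * (alpha * (A - 1) / (M * delta)) ^+ 2 = (A - 1) ^+ 2 / 2 / M ^+ 2.
    have -> : lam = delta ^+ 2 / alpha ^+ 2 by rewrite lamE; field; rewrite lt0r_neq0.
    by field; rewrite !lt0r_neq0.
  set p := alpha * (A - 1) / (M * delta) => h1 h2 h3.
  have p0 : 0 <= p by rewrite /p -tt1 subr_ge0.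
  have := ler_wpM2r p0 h2.
  have -> : - (delta / (M * alpha) * (A - 1)) * p = - (A - 1) ^+ 2 / M ^+ 2.
    by rewrite /p; field; rewrite !lt0r_neq0.
  move=> h4; rewrite mulrC -ler_pdivrMr ?exprn_gt0 // /W /D.
  move: h1 h3 h4; set e := (A - 1) ^+ 2; rewrite -[M ^- 2]/((M ^+ 2)^-1).
  set m := (M ^+ 2)^-1 => *; lra.
split => //.
  apply: le_trans (model_decrease_quad (ltW z0) _ (ltW za)) _; first by rewrite a0.
  by rewrite -/A -/W; lra.
have B0 : 0 <= A - 1 by rewrite subr_ge0 ltW.
exists (A - 1); split => //.
- by rewrite lerBlDl /A ler_piMr // ltW.
(* With [B = A - 1], [2 W] is [2 (z - ln (1 + z))] plus [B^2 - 2 B + 2 ln (1 + B)]. The first part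
   is bounded by [w_ge]; [ln1p_ge] bounds the second below by [B^3 / (2 + B)]. *)
- have := ln1p_ge B0; rewrite (_ : 1 + (A - 1) = A); last by ring.
  rewrite [ln A]lnM ?posrE // => ln_A.
  have -> : (A - 1) ^+ 3 / (2 + (A - 1)) =
    (A - 1) ^+ 2 - 2 * (A - 1) + 2 * (2 * (A - 1) / (2 + (A - 1))).
    by field; apply: lt0r_neq0; lra.
  apply: (@le_trans _ _ (2 * W)); last by lra.
  have -> : 2 * W = 2 * (z + 1 - A) + 2 * ln alpha + (A - 1) ^+ 2.
    by rewrite /W /A; field.
  lra.
- by rewrite tauE /A; field; rewrite lt0r_neq0.
Qed.

End LineSearch.

(** * One step of the algorithm, and the rate *)

Lemma prod_le_mean (R : realType) (k : nat) (E : nat -> R) :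
  (forall i, 0 <= E i) ->
  \prod_(i < k) E i <= ((\sum_(i < k) E i) / k%:R) ^+ k.
Proof.
move=> E0; have := leif_AGM (A := predT) (E := fun i : 'I_k => E i) (fun i _ => E0 i).
by case=> + _; rewrite card_ord big_mkcond [X in X / _]big_mkcond.
Qed.

(** AM-GM on the factors [1 - c r_i] brings in the arithmetic mean of the [r_i]; AM-GM on the [r_i]
    bounds that mean below by their geometric mean, which the telescoped [psi] controls. The sign of
    the base is kept for later comparisons of powers. *)
Lemma rate_of_average_decrease (R : realType) (gap psi r : nat -> R) (c : R) :
  0 < c -> (forall k, 0 < gap k) -> (forall k, 0 < r k) -> (forall k, 0 <= psi k) ->
  (forall k, psi k.+1 <= psi k + ln (r k)) ->
  (forall k, gap k.+1 <= (1 - c * r k) * gap k) ->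
  forall k, (0 < k)%N ->
    0 <= 1 - c * expR (- (psi 0%N / k%:R)) /\
    gap k / gap 0%N <= (1 - c * expR (- (psi 0%N / k%:R))) ^+ k.
Proof.
move=> c0 gap0 r0 psi0 psiS gapS k k0.
have kR0 : 0 < k%:R :> R by rewrite ltr0n.
(* AM-GM needs nonnegative factors; positivity of consecutive gaps provides them. *)
have fac0 i : 0 <= 1 - c * r i.
  by rewrite -(pmulr_lge0 _ (gap0 i)); exact: le_trans (ltW (gap0 _)) (gapS i).
have gap_prod j : gap j <= \prod_(i < j) (1 - c * r i) * gap 0%N.
  elim: j => [|j IH]; first by rewrite big_ord0 mul1r.
  rewrite big_ord_recr /= mulrAC mulrC; apply: le_trans (gapS j) _.
  by rewrite ler_wpM2l.
have psi_prod j : expR (- psi 0%N) <= expR (- psi j) * \prod_(i < j) r i.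
  elim: j => [|j IH]; first by rewrite big_ord0 mulr1.
  rewrite big_ord_recr /= mulrCA; apply: le_trans IH _; rewrite mulrC.
  rewrite ler_wpM2l ?prodr_ge0 // => [i _|]; first exact: ltW.
  rewrite -[r j]lnK ?posrE // -expRD ler_expR.
  by have := psiS j; lra.
pose a := (\sum_(i < k) r i) / k%:R.
have a_ge : expR (- (psi 0%N / k%:R)) <= a.
  have a0 : 0 <= a by rewrite divr_ge0 ?sumr_ge0 // => i _; exact: ltW.
  rewrite -(ler_pXn2r k0) ?nnegrE ?expR_ge0 // -expRM_natl.
  rewrite mulrN mulrCA divff ?gt_eqF // mulr1.
  apply: le_trans (psi_prod k) _.
  apply: (@le_trans _ _ (\prod_(i < k) r i)); last by apply: prod_le_mean => i; exact: ltW.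
  rewrite ler_piMl ?prodr_ge0 // => [i _|]; first exact: ltW.
  by rewrite -expR0 ler_expR oppr_le0.
have meanE : (\sum_(i < k) (1 - c * r i)) / k%:R = 1 - c * a.
  rewrite sumrB sumr_const card_ord -mulr_sumr mulrBl divff ?gt_eqF //.
  by rewrite /a mulrA.
have mean0 : 0 <= 1 - c * a by rewrite -meanE divr_ge0 ?sumr_ge0 // => i _.
have le_a : 1 - c * a <= 1 - c * expR (- (psi 0%N / k%:R)).
  by rewrite lerD2l lerN2 ler_pM2l.
split; first exact: le_trans le_a.
rewrite ler_pdivrMr //; apply: le_trans (gap_prod k) _.
rewrite ler_wpM2r ?(ltW (gap0 _)) //.
apply: le_trans (prod_le_mean k fac0) _; rewrite meanE.
by rewrite lerXn2r // nnegrE // (le_trans mean0).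
Qed.

Section BfgsStep.
Context {R : realType} {n : nat}.
Variables (mu L M : R) (f : 'cV[R]_n -> R).
Hypotheses (mu0 : 0 < mu) (L0 : 0 < L) (M0 : 0 < M).
Hypotheses (C3 : Ck 3 f) (sc : strongly_convex mu f) (lip : lipschitz_gradient L f).
Hypothesis sconc : self_concordant M f.

Let kappa := L / mu.

(** The gradient step [x - g / L] already lowers [f] by at least [|g|^2 / (2 L)]. *)
Lemma gradient_gap_gt0 x y : gradient f x != 0 -> (forall z, f y <= f z) ->
  0 < f x - f y.
Proof.
move=> g0 min_y; have := descent_lemma x (- (L^-1 *: gradient f x)) C3 lip.
have := min_y (x - L^-1 *: gradient f x); have := dot_gt0 g0.
rewrite !(dotNr, dotNl, dotZr, dotZl) opprK.
move: (dot _ _) => e e0 h1 h2.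
have : 0 < e / L by rewrite divr_gt0.
have : L / 2 * (L^-1 * (L^-1 * e)) = e / L / 2 by field; rewrite lt0r_neq0.
have : L^-1 * e = e / L by rewrite mulrC.
by move=> *; lra.
Qed.

Variables (x : 'cV[R]_n) (B : 'M[R]_n).
Hypotheses (g0 : gradient f x != 0) (spdB : spd B).

Let g := gradient f x.
Let d := bfgs_direction f B x.
Let t := bfgs_step M L f B x.
Let x' := x + t *: d.
Let s := x' - x.
Let y := gradient f x' - gradient f x.
Let D := f x - f x'.

Let Bd : B *m d = - g.
Proof. by rewrite /d /bfgs_direction mulmxN mulKVmx // spd_unitmx. Qed.

Let d_neq0 : d != 0.
Proof.
by apply: contra g0 => /eqP d0; rewrite -oppr_eq0 -Bd d0 mulmx0.
Qed.

Let sE : s = t *: d.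
Proof. by rewrite /s /x' addrAC subrr add0r. Qed.

Let rho := - dot g d.

Let rho_gt0 : 0 < rho.
Proof. by have [_ /(_ d d_neq0)] := spdB; rewrite Bd dotNr dotC. Qed.

(** The line search result with [lam = L |d|^2], which bounds the curvature along the whole line; at
    [x] this bound gives [alpha <= 1]. *)
Lemma bfgs_step_progress :
  [/\ 0 < t, rho ^+ 2 <= L * dot d d * (2 * D) &
      rho ^+ 2 * t <= 2 * D * (1 + Num.sqrt 2 * M * Num.sqrt D) ^+ 2 * dot y d].
Proof.
pose delta := local_norm f x d.
have hess_gt0 u v : v != 0 -> 0 < dot v (hessian f u *m v).
  move=> v0; apply: lt_le_trans (strongly_convex_hessian u v C3 sc).
  by rewrite mulr_gt0 // dot_gt0.
have delta0 : 0 < delta by rewrite sqrtr_gt0 hess_gt0.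
have delta2 : delta ^+ 2 = dot d (hessian f x *m d) by rewrite sqr_sqrtr // ltW // hess_gt0.
have sL : 0 < Num.sqrt L by rewrite sqrtr_gt0.
have ed := enorm_gt0 d_neq0.
pose alpha := delta / (Num.sqrt L * enorm d).
have sLe2 : (Num.sqrt L * enorm d) ^+ 2 = L * dot d d.
  by rewrite exprMn enorm_sqr sqr_sqrtr // ltW.
have alpha01 : 0 < alpha <= 1.
  rewrite divr_gt0 ?mulr_gt0 //= ler_pdivrMr ?mulr_gt0 // mul1r.
  rewrite -ler_sqr ?nnegrE ?mulr_ge0 ?(ltW delta0) ?(ltW sL) ?(ltW ed) //.
  by rewrite sLe2 delta2 lipschitz_gradient_hessian.
have lamE : delta ^+ 2 = alpha ^+ 2 * (L * dot d d).
  by rewrite -sLe2 /alpha -exprMn divfK // lt0r_neq0 // mulr_gt0.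
have := @adaptive_step_decrease R (fun u => f (x + u *: d))
  (fun u => dot (gradient f (x + u *: d)) d)
  (fun u => dot d (hessian f (x + u *: d) *m d))
  (fun u => third_derivative f (x + u *: d) d d d) M delta rho M0 delta0
  (is_derive_line1 x d C3) (is_derive_line2 x d C3) (is_derive_line3 x d C3)
  (fun u => hess_gt0 _ _ d_neq0) (fun u => sconc.2 _ _).
rewrite scale0r addr0 opprK => /(_ erefl (esym delta2) (L * dot d d) alpha t).
move=> /(_ rho_gt0 alpha01 lamE (fun u => lipschitz_gradient_hessian _ d C3 lip) erefl).
by rewrite -dotBl.
Qed.

Let t_gt0 : 0 < t.
Proof. by have [] := bfgs_step_progress. Qed.

Lemma bfgs_secant_gt0 : 0 < dot y s.
Proof.
have := strongly_monotone_gradient x' x C3 sc; apply: lt_le_trans.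
by rewrite mulr_gt0 // dot_gt0 // -/s sE scaler_eq0 negb_or d_neq0 lt0r_neq0.
Qed.

Lemma spd_bfgs_step : spd (bfgs_update B s y).
Proof.
apply: spd_bfgs_update => //; last exact: bfgs_secant_gt0.
by rewrite sE scaler_eq0 negb_or d_neq0 lt0r_neq0.
Qed.

Let r := L * dot g s ^+ 2 / (dot g g * dot y s).

Let gs : dot g s = - (t * rho).
Proof. by rewrite sE dotZr /rho mulrN opprK. Qed.

Lemma bfgs_ratio_gt0 : 0 < r.
Proof.
have gs2 : 0 < dot g s ^+ 2 by rewrite gs sqrrN exprn_gt0 // mulr_gt0.
by rewrite divr_gt0 // mulr_gt0 // ?dot_gt0 ?bfgs_secant_gt0.
Qed.

(** Cocoercivity allows [Psi_bfgs_update] for [B / L] and [y / L]. As [B s = - t g], the step length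
    cancels and the ratio becomes [r]. *)
Lemma Psi_bfgs_step :
  Psi (L^-1 *: bfgs_update B s y) <= Psi (L^-1 *: B) + ln r.
Proof.
have Li0 : 0 < L^-1 by rewrite invr_gt0.
rewrite bfgs_updateZ ?lt0r_neq0 //.
apply: le_trans (Psi_bfgs_update _ _ _ _) _.
- exact: spdZ.
- by rewrite sE scaler_eq0 negb_or d_neq0 lt0r_neq0.
- by rewrite dotZl mulr_gt0 // bfgs_secant_gt0.
- rewrite !dotZl dotZr ler_wpM2l ?(ltW Li0) // ler_pdivrMl //.
  exact: (gradient_cocoercive x' x (ltW mu0) L0 C3 sc lip).
rewrite lerD2l.
have Bs : B *m s = - t *: g by rewrite sE -scalemxAr Bd scalerN scaleNr.
rewrite -scalemxAl Bs !(dotZl, dotZr) (dotC s g) /r le_eqVlt; apply/orP; left; apply/eqP.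
congr ln; field.
by rewrite !lt0r_neq0 ?bfgs_secant_gt0 ?dot_gt0.
Qed.

Lemma bfgs_step_decrease (Gamma : R) (xstar : 'cV[R]_n) :
  (1 + Num.sqrt 2 * M * Num.sqrt D) ^+ 2 <= Gamma ->
  f x' - f xstar <= (1 - (kappa * Num.min Gamma kappa)^-1 * r) * (f x - f xstar).
Proof.
have [_ prog1 prog2] := bfgs_step_progress => le_Gamma.
have ys0 := bfgs_secant_gt0; have gg0 := dot_gt0 g0; have dd0 := dot_gt0 d_neq0.
have D0 : 0 <= D.
  have : 0 <= L * dot d d * (2 * D) by apply: le_trans prog1; exact: sqr_ge0.
  by rewrite mulrA pmulr_rge0 // !mulr_gt0.
have kappa0 : 0 < kappa by rewrite divr_gt0.
have Gamma0 : 0 < Gamma.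
  apply: lt_le_trans le_Gamma; rewrite exprn_gt0 // ltr_wpDr //.
  by rewrite !mulr_ge0 ?sqrtr_ge0 // ltW.
set m := Num.min Gamma kappa.
have m0 : 0 < m by rewrite lt_min Gamma0.
have ysE : dot y s = t * dot y d by rewrite sE dotZr.
(* The [Gamma] case is the third progress bound times [t]; the [kappa] case is the second times
   [t^2], with [mu |s|^2 <= y.s]. *)
have key : dot g s ^+ 2 <= 2 * D * m * dot y s.
  rewrite gs sqrrN exprMn /m; have [_|_] := leP Gamma kappa.
    apply: (@le_trans _ _ (t * (2 * D * (1 + Num.sqrt 2 * M * Num.sqrt D) ^+ 2 * dot y d))).
      by rewrite expr2 -mulrA ler_wpM2l ?(ltW t_gt0) // mulrC.
    rewrite ysE mulrCA ler_wpM2r //; last by rewrite ler_wpM2l // mulr_ge0.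
    by rewrite -ysE ltW.
  apply: (@le_trans _ _ (t ^+ 2 * (L * dot d d * (2 * D)))).
    by rewrite ler_wpM2l // sqr_ge0.
  have -> : t ^+ 2 * (L * dot d d * (2 * D)) = 2 * D * kappa * (mu * dot s s).
    by rewrite sE !(dotZl, dotZr) /kappa; field; rewrite lt0r_neq0.
  apply: ler_wpM2l; first by apply: mulr_ge0 (ltW kappa0); rewrite mulr_ge0.
  exact: strongly_monotone_gradient C3 sc.
have PL := gradient_dominated x xstar mu0 C3 sc.
(* By [PL], [2 mu r (f x - f xstar) <= r |g|^2 = L (g.s)^2 / (y.s)], and [key] bounds this by
   [2 L m D]. *)
suff : r * (f x - f xstar) <= kappa * m * D.
  rewrite -(ler_pdivrMl _ _ (mulr_gt0 kappa0 m0)) mulrA /D => *; lra.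
have mu2 : 0 < 2 * mu by rewrite mulr_gt0.
rewrite -(ler_pM2l mu2) mulrCA.
apply: (@le_trans _ _ (r * dot g g)).
  by rewrite ler_wpM2l // ltW // bfgs_ratio_gt0.
have -> : r * dot g g = L / dot y s * dot g s ^+ 2.
  by rewrite /r; field; rewrite !lt0r_neq0.
apply: (@le_trans _ _ (L / dot y s * (2 * D * m * dot y s))).
  by rewrite ler_wpM2l // divr_ge0 // ltW.
rewrite [leLHS](_ : _ = 2 * mu * (kappa * m * D)) // /kappa; field.
by rewrite !lt0r_neq0.
Qed.

End BfgsStep.

Unset Implicit Arguments.

Theorem theorem3 (R : realType) (n : nat) (mu L M : R) (f : 'cV[R]_n -> R)
    (xstar x0 : 'cV[R]_n) (B0 : 'M[R]_n)
    (x : nat -> 'cV[R]_n) (B : nat -> 'M[R]_n) :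
  0 < mu -> 0 < L -> 0 < M ->
  Ck 3 f ->
  strongly_convex mu f ->
  lipschitz_gradient L f ->
  self_concordant M f ->
  unique_minimizer f xstar ->
  spd B0 ->
  adaptive_bfgs M L f x0 B0 x B ->
  (forall k : nat, gradient f (x k) != 0) ->
  let kappa := L / mu in
  let Delta := f x0 - f xstar in
  let Bbar0 := L^-1 *: B0 in
  let Gamma := (1 + Num.sqrt 2 * M * Num.sqrt Delta) ^+ 2 in
  (forall k : nat, (1 <= k)%N ->
     (f (x k) - f xstar) / (f x0 - f xstar)
       <= (1 - 1 / (kappa * Num.min Gamma kappa)
               * expR (- (Psi Bbar0 / k%:R))) ^+ k)
  /\
  (forall k : nat, 2 * Psi Bbar0 <= k%:R ->
     (f (x k) - f xstar) / (f x0 - f xstar)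
       <= (1 - 1 / (2 * kappa * Num.min Gamma kappa)) ^+ k).
Proof.
move=> mu0 L0 M0 C3 sc lip sconc [min_xstar _] spdB0 [x0E B0E step] g0.
move=> kappa Delta Bbar0 Gamma.
set m := Num.min Gamma kappa.
have kappa0 : 0 < kappa by rewrite divr_gt0.
have Gamma0 : 0 < Gamma.
  by rewrite exprn_gt0 // ltr_wpDr // !mulr_ge0 ?sqrtr_ge0 // ltW.
have m0 : 0 < m by rewrite lt_min Gamma0.
have km0 : 0 < kappa * m by rewrite mulr_gt0.
pose gap k := f (x k) - f xstar.
have gap0 k : 0 < gap k by apply: (gradient_gap_gt0 L0 C3 lip).
pose s k := x k.+1 - x k.
pose y k := gradient f (x k.+1) - gradient f (x k).
pose r k := L * dot (gradient f (x k)) (s k) ^+ 2 /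
  (dot (gradient f (x k)) (gradient f (x k)) * dot (y k) (s k)).
have r_gt0 k : spd (B k) -> 0 < r k.
  by rewrite /r /y /s (step k).1; exact: (bfgs_ratio_gt0 mu0 L0 M0 C3 sc lip sconc).
(* [f (x k) <= f x0] gives [D <= Delta], so one [Gamma] serves all steps. *)
have decrease k : spd (B k) -> f (x k) <= f x0 ->
    gap k.+1 <= (1 - (kappa * m)^-1 * r k) * gap k.
  move=> spdB le0; have := min_xstar (x k.+1).
  rewrite /gap /r /y /s (step k).1 => min_k.
  apply: (bfgs_step_decrease mu0 L0 M0 C3 sc lip sconc) => //.
  rewrite lerXn2r ?nnegrE ?addr_ge0 ?mulr_ge0 ?sqrtr_ge0 ?(ltW M0) //.
  rewrite lerD2l ler_wpM2l ?mulr_ge0 ?sqrtr_ge0 ?(ltW M0) //.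
  by rewrite ler_wsqrtr // /Delta; lra.
have inv k : spd (B k) /\ f (x k) <= f x0.
  elim: k => [|k [spdB le0]]; first by rewrite x0E B0E.
  split.
    rewrite (step k).2 (step k).1.
    exact: (spd_bfgs_step mu0 L0 M0 C3 sc lip sconc).
  apply: (le_trans _ le0); have := decrease k spdB le0.
  have : 0 < (kappa * m)^-1 * r k * gap k.
    by apply: mulr_gt0 (gap0 k); apply: mulr_gt0 (r_gt0 k spdB); rewrite invr_gt0.
  by rewrite /gap => *; lra.
have rate := @rate_of_average_decrease R gap (fun k => Psi (L^-1 *: B k)) r (kappa * m)^-1.
have {}rate k : (0 < k)%N -> 0 <= 1 - (kappa * m)^-1 * expR (- (Psi Bbar0 / k%:R)) /\
    gap k / gap 0%N <= (1 - (kappa * m)^-1 * expR (- (Psi Bbar0 / k%:R))) ^+ k.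
  rewrite /Bbar0 -B0E; move: k; apply: rate => //.
  - by rewrite invr_gt0.
  - by move=> k; apply: r_gt0; have [] := inv k.
  - move=> k; have [spdB _] := inv k.
    by have [] := spd_det_gt0_Psi_ge0 (spdZ (_ : 0 < L^-1) spdB); rewrite ?invr_gt0.
  - move=> k; have [spdB _] := inv k.
    rewrite /r /y /s (step k).2 (step k).1.
    exact: (Psi_bfgs_step mu0 L0 M0 C3 sc lip sconc).
  - by move=> k; have [] := inv k; exact: decrease.
split=> k.
  by move=> k0; rewrite div1r -x0E; have [] := rate k k0.
(* [k = 0] is possible when [Psi Bbar0] is 0; both sides are then 1. *)
rewrite -x0E; case: (posnP k) => [->|k0] Psi_k.
  by rewrite expr0 divff // gt_eqF // gap0.
have kR0 : 0 < k%:R :> R by rewrite ltr0n.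
have [base0 rate_k] := rate k k0.
(* [exp (- u) >= 1 - u] with [u = Psi Bbar0 / k <= 1 / 2]. *)
have half_le : 1 / 2 <= expR (- (Psi Bbar0 / k%:R)).
  apply: le_trans (expR_ge1Dx _).
  have : Psi Bbar0 / k%:R <= 1 / 2 by rewrite ler_pdivrMr //; lra.
  lra.
have base_le : 1 - (kappa * m)^-1 * expR (- (Psi Bbar0 / k%:R)) <= 1 - 1 / (2 * kappa * m).
  have -> : 1 / (2 * kappa * m) = (kappa * m)^-1 * (1 / 2).
    by rewrite -mulrA invfM mulrC mulr1 mulrC mul1r.
  by rewrite lerD2l lerN2 ler_wpM2l // invr_ge0 ltW.
by apply: le_trans rate_k _; rewrite lerXn2r // nnegrE // (le_trans base0).
Qed.
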